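(* Let $\mathcal{G}=(\mathcal{V},\mathcal{E})$ be a connected distance-transitive graph with $n\ge 2$ vertices, valency $\nu$, diameter $D$, and adjacency matrix $A$, and let $\eta_0>\eta_1>\cdots>\eta_D$ be the eigenvalues, in decreasing order, of its intersection matrix. Then the optimal solution of the fastest mixing Markov chain (FMMC) problem on $\mathcal{G}$, with common edge transition probability $\alpha$ on all the edges, is $$\alpha^\star=\min\left\{\frac{1}{\nu},\ \frac{2}{2\nu-(\eta_1+\eta_D)}\right\},\qquad \mu^\star=\max\left\{\frac{\eta_1}{\nu},\ \frac{\eta_1-\eta_D}{2\nu-(\eta_1+\eta_D)}\right\};$$ that is, the matrix $P^\star=I-\alpha^\star(\nu I-A)$ is feasible for the FMMC problem, it minimizes $\mu(P)$ over all feasible $P$, and the minimum value is $\mu(P^\star)=\mu^\star$.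
   Context: Graphs are finite, simple and undirected, with $\mathcal{V}=\{1,\ldots,n\}$. The feasible set of the FMMC problem is $$\mathcal{C}=\{P\in\mathbb{R}^{n\times n} : P\ge 0 \text{ (elementwise)},\ P\mathbf{1}=\mathbf{1},\ P=P^T,\ P_{ij}=0 \text{ for } i\neq j,\ \{i,j\}\notin\mathcal{E}\},$$ where $\mathbf{1}$ is the all-ones vector. For $P\in\mathcal{C}$ with eigenvalues $1=\lambda_1(P)\ge\cdots\ge\lambda_n(P)\ge -1$, let $\mu(P)=\max_{i=2,\ldots,n}|\lambda_i(P)|$. The FMMC problem is to minimize $\mu(P)$ over $P\in\mathcal{C}$. Let $\delta(u,v)$ denote graph distance. The graph is distance-transitive if for any vertices $u,v,x,y$ with $\delta(u,v)=\delta(x,y)$ there is an automorphism $g$ of $\mathcal{G}$ with $g(u)=x$ and $g(v)=y$. In such a graph all vertices have the same valency $\nu$. For $0\le k\le D$ choose vertices $u,v$ with $\delta(u,v)=k$ and set $$a_k=|\{w:\delta(u,w)=1,\delta(w,v)=k\}|,\quad b_k=|\{w:\delta(u,w)=1,\delta(w,v)=k+1\}|,\quad c_k=|\{w:\delta(u,w)=1,\delta(w,v)=k-1\}|;$$ these numbers do not depend on the choice of $u,v$. The intersection matrix $B$ is the tridiagonal $(D+1)\times(D+1)$ matrix, with rows and columns indexed by $0,\ldots,D$, with diagonal entries $B_{kk}=a_k$, superdiagonal entries $B_{k,k+1}=b_k$ ($0\le k\le D-1$), and subdiagonal entries $B_{k,k-1}=c_k$ ($1\le k\le D$). It is a known fact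 that its eigenvalues are precisely the $D+1$ distinct eigenvalues of $A$. *)

(* Defs.v *)
From HB Require Import structures.
From mathcomp Require Import all_boot all_order all_algebra all_fingroup.
From mathcomp Require Import classical_sets reals.

Set Implicit Arguments.
Unset Strict Implicit.
Unset Printing Implicit Defensive.

Import Order.TTheory GRing.Theory Num.Theory.
Local Open Scope ring_scope.

Definition has_walk (V : finType) (e : rel V) (k : nat) (u v : V) : bool :=
  [exists p : k.-tuple V, path e u p && (last u p == v)].

(* The least length of a walk from u to v; a shortest walk has fewer than
   #|V| edges, and the junk value #|V| is returned when there is no walk. *)
Definition dist (V : finType) (e : rel V) (u v : V) : nat :=
  find (fun k => has_walk e k u v) (iota 0 #|V|).

Definition diameter (V : finType) (e : rel V) : nat :=
  (\max_(u : V) \max_(v : V) dist e u v)%N.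

Definition connected_graph (V : finType) (e : rel V) : Prop :=
  forall u v : V, connect e u v.

Definition automorphism (V : finType) (e : rel V) (g : {perm V}) : Prop :=
  forall x y : V, e (g x) (g y) = e x y.

Definition distance_transitive (V : finType) (e : rel V) : Prop :=
  forall u v x y : V, dist e u v = dist e x y ->
    exists g : {perm V}, [/\ automorphism e g, g u = x & g v = y].

Definition valency (V : finType) (e : rel V) (u : V) : nat := #|[pred w | e u w]|.

(* |{w : d(u,w) = 1, d(w,v) = j}| for one chosen pair (u,v) with d(u,v) = k
   (0 if there is no such pair, which does not happen for k <= diameter e
   when the graph is connected). *)
Definition intersection_number (V : finType) (e : rel V) (k j : nat) : nat :=
  if [pick uv : V * V | dist e uv.1 uv.2 == k] is Some (u, v)
  then #|[pred w | (dist e u w == 1%N) && (dist e w v == j)]|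
  else 0%N.

Definition a_num (V : finType) (e : rel V) (k : nat) := intersection_number e k k.
Definition b_num (V : finType) (e : rel V) (k : nat) := intersection_number e k k.+1.
(* only used for k >= 1, so the truncation in k.-1 is harmless *)
Definition c_num (V : finType) (e : rel V) (k : nat) := intersection_number e k k.-1.

Definition intersection_matrix (R : nzRingType) (V : finType) (e : rel V) :
    'M[R]_((diameter e).+1) :=
  \matrix_(k, j)
    (if (j : nat) == k then (a_num e k)%:R
     else if (j : nat) == k.+1 then (b_num e k)%:R
     else if j.+1 == k then (c_num e k)%:R
     else 0).

Definition adjacency (R : nzRingType) (n : nat) (e : rel 'I_n) : 'M[R]_n :=
  \matrix_(i, j) (e i j)%:R.

Definition feasible (R : realType) (n : nat) (e : rel 'I_n) (P : 'M[R]_n) : Prop :=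
  [/\ forall i j, 0 <= P i j,
      P *m const_mx 1 = const_mx 1 :> 'cV[R]_n,
      P = P^T
    & forall i j, i != j -> ~~ e i j -> P i j = 0].

(* The eigenvalues of P with multiplicity, in nonincreasing order: the unique
   nonincreasing list of roots that splits the characteristic polynomial.
   It exists for every symmetric P; the junk value is the empty list. *)
Definition spectrum (R : realType) (n : nat) (P : 'M[R]_n) : seq R :=
  xget [::] (fun s : seq R =>
    sorted >=%R s /\ char_poly P = \prod_(x <- s) ('X - x%:P)).

(* Lists are indexed from 0, so index i stands for the (i+1)-st largest
   eigenvalue; the default 0 is neutral since the absolute values are >= 0. *)
Definition mu (R : realType) (n : nat) (P : 'M[R]_n) : R :=
  \big[Num.max/0]_(1 <= i < n) `|(spectrum P)`_i|.

(* Main.v *)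
(* On the orthogonal complement of the all-ones vector 1, the quadratic form of
   a feasible P is bounded by mu(P): the matrix P - J/n has the spectrum of P
   with one eigenvalue 1 replaced by 0.  Evaluate this bound at the translates
   of an eigenvector of A (orthogonal to 1, with eigenvalue theta) under the
   automorphisms of the graph and average: distance-transitivity makes the
   averaged P constant, equal to some c, on the edges, so that
   |1 - c (nu - theta)| <= mu(P) with c nu <= 1.  Taking theta = eta_1 and
   theta = eta_D bounds mu(P) below by mu*, whatever c is.  Conversely every
   eigenvalue of P* other than the simple eigenvalue 1 is
   1 - alpha* (nu - theta) with eta_D <= theta <= eta_1.  The spectra of A and
   of the intersection matrix B agree because A C = C B, where C is the
   characteristic matrix of the partition by distance to a fixed vertex. *)
Require Import Defs.
From HB Require Import structures.
From mathcomp Require Import all_boot all_order all_algebra all_fingroup.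
From mathcomp Require Import classical_sets reals.
From mathcomp Require Import complex ring lra.

Set Implicit Arguments.
Unset Strict Implicit.
Unset Printing Implicit Defensive.

Import Order.TTheory GRing.Theory Num.Theory.
Local Open Scope ring_scope.

(** * Real symmetric matrices *)

Lemma char_poly_invmx_conj (F : comUnitRingType) n (U A : 'M[F]_n) :
  U \in unitmx -> char_poly (invmx U *m A *m U) = char_poly A.
Proof.
move=> Uu; rewrite /char_poly.
have -> : char_poly_mx (invmx U *m A *m U) =
    map_mx polyC (invmx U) *m char_poly_mx A *m map_mx polyC U.
  rewrite /char_poly_mx !map_mxM mulmxBr mulmxBl; congr (_ - _).
  by rewrite scalar_mxC -mulmxA -map_mxM mulVmx// map_mx1 mulmx1.
rewrite !det_mulmx mulrAC -det_mulmx -map_mxM mulVmx//.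
by rewrite map_mx1 det1 mul1r.
Qed.

(** The spectral theorem over the complex numbers, read back over [R]: [w i] is the squared modulus
    of the [i]-th coordinate of [x] in a unitary eigenbasis, so that only real data remain. *)
Lemma symmetric_diagonalization (R : rcfType) n (S : 'M[R]_n) : S = S^T ->
  exists d : 'I_n -> R,
    char_poly S = \prod_i ('X - (d i)%:P) /\
    forall x : 'rV[R]_n, exists w : 'I_n -> R,
      [/\ forall i, 0 <= w i,
          \sum_i w i = (x *m x^T) 0 0
        & \sum_i d i * w i = (x *m S *m x^T) 0 0].
Proof.
move=> S_sym; pose f : {rmorphism R -> R[i]} := real_complex R; pose M := map_mx f S.
have M_real : M \is a mxOver Num.real.
  by apply/mxOverP => i j; rewrite mxE complex_real.
have M_sym : M \is symmetricmx.
  by apply/is_hermitianmxP; rewrite expr0 scale1r map_mx_id// map_trmx -S_sym.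
have M_herm := realsym_hermsym M_sym M_real.
have /hermitian_normalmx/orthomx_spectralP := M_herm.
have /mxOverP sp_real := hermitian_spectral_diag_real M_herm.
set U := spectralmx M; set D := spectral_diag M in sp_real * => M_eq.
have U_unit : U \in unitmx by apply: spectral_unit.
have UV : invmx U = (map_mx Num.conj U^T).
  by rewrite invmx_unitary ?map_trmx ?spectral_unitarymx.
pose d i := complex.Re (D 0 i).
have dE i : f (d i) = D 0 i by apply: RRe_real.
exists d; split.
  apply: (@map_poly_inj _ _ f); rewrite rmorph_prod /= map_char_poly -/M.
  rewrite M_eq char_poly_invmx_conj// char_poly_trig ?diag_mx_is_trig//.
  apply: eq_bigr => i _; rewrite rmorphB /= map_polyX map_polyC /= -/(f (d i)) dE.
  by rewrite mxE eqxx.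
move=> x; pose z := map_mx f x *m invmx U.
(* [U] is unitary and [x] is real, so the conjugate transpose of [x U^-1] is [U x^T]; both quadratic
   forms then become diagonal in [z]. *)
have zJ : map_mx Num.conj z^T = U *m (map_mx f x)^T.
  rewrite /z UV trmx_mul map_mxM.
  congr (_ *m _); apply/matrixP => i j; rewrite !mxE; first exact: conjCK.
  by apply: conj_Creal; apply/complex_realP; eexists.
pose w i := complex.Re (`|z 0 i| ^+ 2).
have wE i : f (w i) = `|z 0 i| ^+ 2 by apply: RRe_real; rewrite realX.
have f_inj : injective f := fmorph_inj _.
have fxE (N : 'M[R]_n) : f ((x *m N *m x^T) 0 0) =
     (map_mx f x *m map_mx f N *m (map_mx f x)^T) 0 0.
  by rewrite map_trmx -!map_mxM [RHS]mxE.
exists w; split=> [i||].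
- by rewrite -ler0c -/(f (w i)) wE exprn_ge0.
- apply: f_inj; rewrite -[X in (X *m x^T)]mulmx1 fxE map_mx1 mulmx1.
  rewrite -[X in X *m _^T](mulmxKV U_unit) -/z -mulmxA -zJ mxE rmorph_sum.
  by apply: eq_bigr => i _; rewrite /= wE normCK !mxE.
- apply: f_inj; rewrite fxE -/M M_eq !mulmxA -/z -(mulmxA _ U) -zJ mxE rmorph_sum.
  apply: eq_bigr => i _; rewrite rmorphM /= wE dE normCK mul_mx_diag !mxE.
  by rewrite mulrCA mulrA.
Qed.

Lemma det_scalar_rank1 (K : comNzRingType) n (a : K) (u : 'cV[K]_n) (v : 'rV_n) :
  a * \det (a%:M + u *m v) = a ^+ n * (a + (v *m u) 0 0).
Proof.
(* Two column reductions of a bordered matrix; [a] need not be invertible. *)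
pose Z := block_mx (a%:M) (- u) v (1%:M : 'M_1).
have detZ : \det Z = \det (a%:M + u *m v).
  have := det_mulmx Z (block_mx 1%:M 0 (- v) 1%:M).
  rewrite det_lblock !det1 !mulr1 => <-.
  rewrite mulmx_block !mulmx1 !mul1mx !mulmx0 !mulmxN mulNmx opprK.
  by rewrite subrr !add0r det_ublock det1 mulr1.
have := det_mulmx Z (block_mx 1%:M u 0 a%:M).
rewrite det_ublock det1 mul1r det_scalar1 detZ mulrC => <-.
rewrite mulmx_block !mulmx1 !mul1mx !mulmx0 !addr0 mulNmx.
rewrite -scalar_mxC subrr det_lblock det_scalar; congr (_ * _).
by rewrite det_mx11 !mxE eqxx mulr1n addrC.
Qed.

(** With [u v] the matrix J/n, [P u = u] gives (X - P)((X - 1) + u v) = (X - 1)(X - P + u v). Take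
    determinants, evaluate the rank-one perturbation, and cancel (X - 1)^n. *)
Lemma char_poly_deflation (F : numFieldType) n (P : 'M[F]_n) :
    (0 < n)%N -> P *m const_mx 1 = const_mx 1 :> 'cV_n ->
  ('X - 1) * char_poly (P - const_mx n%:R^-1) = 'X * char_poly P.
Proof.
move=> n_gt0 P1.
pose u : 'cV[{poly F}]_n := const_mx (n%:R^-1)%:P.
pose v : 'rV[{poly F}]_n := const_mx 1.
have uv : u *m v = map_mx polyC (const_mx n%:R^-1).
  by apply/matrixP => i j; rewrite !mxE big_ord1 !mxE mulr1.
have vu : (v *m u) 0 0 = 1.
  rewrite mxE (eq_bigr (fun=> (n%:R^-1)%:P)) => [|i _]; last by rewrite !mxE mul1r.
  rewrite sumr_const card_ord -polyCMn -(mulr_natr n%:R^-1) mulVf// pnatr_eq0.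
  by rewrite -lt0n.
have Pu : map_mx polyC P *m u = u.
  have -> : u = map_mx polyC (n%:R^-1 *: const_mx 1).
    by apply/matrixP => i j; rewrite !mxE mulr1.
  by rewrite -map_mxM -scalemxAr P1.
have key : char_poly_mx P *m (('X - 1)%:M + u *m v) =
    ('X - 1)%:M *m char_poly_mx (P - const_mx n%:R^-1).
  have -> : char_poly_mx (P - const_mx n%:R^-1) = char_poly_mx P + u *m v.
    by rewrite /char_poly_mx map_mxB -uv opprB addrA addrAC.
  rewrite mulmxDr mul_mx_scalar mul_scalar_mx [RHS]scalerDr; congr (_ + _).
  by rewrite mulmxA mulmxBl Pu mulmxBl mul_scalar_mx -scalemxAl scalerBl scale1r.
have := congr1 determinant key; rewrite !det_mulmx det_scalar -!/(char_poly _) => E.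
have := det_scalar_rank1 ('X - 1) u v; rewrite vu subrK => E2.
have X1 : 'X - 1 != 0 :> {poly F} by rewrite -polyC1 polyXsubC_eq0.
apply: (@mulfI _ (('X - 1) ^+ n)); first by rewrite expf_neq0.
by rewrite mulrCA -E mulrCA E2; ring.
Qed.

Lemma mulmx_tr_ge0 (R : realDomainType) n (x : 'rV[R]_n) : 0 <= (x *m x^T) 0 0.
Proof. by rewrite mxE sumr_ge0// => i _; rewrite mxE -expr2 sqr_ge0. Qed.

Lemma mulmx_tr_gt0 (R : realDomainType) n (x : 'rV[R]_n) :
  x != 0 -> 0 < (x *m x^T) 0 0.
Proof.
move=> x0; rewrite lt_def mulmx_tr_ge0 andbT; apply: contra x0.
rewrite mxE psumr_eq0 => [/allP x0|i _]; last by rewrite mxE -expr2 sqr_ge0.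
apply/eqP/rowP => i; apply/eqP; have := x0 i (mem_index_enum _).
by rewrite !mxE mulf_eq0 orbb.
Qed.

Lemma quadratic_formE (R : comNzRingType) n (W : 'M[R]_n) (x : 'rV_n) :
  (x *m W *m x^T) 0 0 = \sum_i \sum_j W i j * x 0 i * x 0 j.
Proof.
rewrite mxE exchange_big; apply: eq_bigr => i _; rewrite !mxE mulr_suml.
by apply: eq_bigr => j _; rewrite [x 0 j * _]mulrC.
Qed.

(** Expanding the square, the row sums and, by symmetry, the column sums each contribute [r] times
    the squared norm. The left side ignores the diagonal of [W], which the averaging argument
    exploits. *)
Lemma dirichlet_form (R : comNzRingType) n (W : 'M[R]_n) (r : R) (x : 'rV_n) :
    W = W^T -> (forall i, \sum_j W i j = r) ->
  \sum_i \sum_j W i j * (x 0 i - x 0 j) ^+ 2 =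
    2 * (r * (x *m x^T) 0 0 - (x *m W *m x^T) 0 0).
Proof.
move=> W_sym W_r; rewrite quadratic_formE.
have E i : \sum_j W i j * x 0 i ^+ 2 = r * x 0 i ^+ 2 by rewrite -mulr_suml W_r.
have E' : r * (x *m x^T) 0 0 = \sum_i \sum_j W i j * x 0 i ^+ 2.
  rewrite mxE mulr_sumr; apply: eq_bigr => i _.
  by rewrite E mxE expr2.
have E'' : r * (x *m x^T) 0 0 = \sum_i \sum_j W i j * x 0 j ^+ 2.
  rewrite E' exchange_big; apply: eq_bigr => i _; apply: eq_bigr => j _.
  by rewrite {1}W_sym mxE.
rewrite mulr_natl mulr2n {1}E' E'' -!sumrB -big_split; apply: eq_bigr => i _.
rewrite -!sumrB -big_split; apply: eq_bigr => j _ /=; ring.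
Qed.

(** * The second largest eigenvalue modulus of a feasible matrix *)

Lemma feasible_sum1 (R : realType) n (e : rel 'I_n) (P : 'M[R]_n) :
  feasible e P -> forall i, \sum_j P i j = 1.
Proof.
move=> [_ P1 _ _] i; have /colP/(_ i) := P1; rewrite !mxE => <-.
by apply: eq_bigr => j _; rewrite mxE mulr1.
Qed.

Lemma eigenvalue_le_sum (R : realFieldType) n (W : 'M[R]_n) (r a : R) :
    W = W^T -> (forall i j, 0 <= W i j) -> (forall i, \sum_j W i j = r) ->
  eigenvalue W a -> a <= r.
Proof.
move=> W_sym W_ge0 W_r /eigenvalueP[x xW x0].
have := dirichlet_form x W_sym W_r; rewrite xW -scalemxAl [X in _ - X]mxE -mulrBl => E.
have := mulmx_tr_gt0 x0 => x_gt0.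
rewrite -subr_ge0 -(pmulr_lge0 _ x_gt0) -(pmulr_rge0 _ (ltr0n _ 2)) -E.
by do 2![apply: sumr_ge0 => ? _]; rewrite mulr_ge0// sqr_ge0.
Qed.

Lemma spectrumP (R : realType) n (P : 'M[R]_n) : P = P^T ->
  sorted >=%R (spectrum P) /\
  char_poly P = \prod_(x <- spectrum P) ('X - x%:P).
Proof.
move=> /symmetric_diagonalization[d [dP _]].
apply: (@xgetPex _ [::] (fun s : seq R => sorted >=%R s /\
  char_poly P = \prod_(x <- s) ('X - x%:P))).
exists (sort >=%R (codom d)); split.
  by apply: sort_sorted => x y; rewrite le_total.
by rewrite (perm_big _ (permEl (perm_sort _ _))) big_image.
Qed.

(** The all-ones vector gives the eigenvalue 1 and no eigenvalue exceeds 1, so 1 heads the sorted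
    list and [mu] ranges exactly over the tail [s]. *)
Lemma spectrum_feasible (R : realType) n (e : rel 'I_n) (P : 'M[R]_n) :
    (0 < n)%N -> feasible e P ->
  exists s : seq R, spectrum P = 1 :: s /\
    char_poly P = ('X - 1) * \prod_(x <- s) ('X - x%:P).
Proof.
move=> n_gt0 P_feas; have := feasible_sum1 P_feas.
case: (P_feas) => P_ge0 P1 P_sym _ P_sum1.
have [] := spectrumP P_sym; set t := spectrum P => t_sorted t_char.
have in_t a : (a \in t) = eigenvalue P a.
  by rewrite eigenvalue_root_char t_char root_prod_XsubC.
have t1 : 1 \in t.
  rewrite in_t; apply/eigenvalueP; exists (const_mx 1).
    by rewrite scale1r P_sym -[LHS]trmxK trmx_mul trmxK trmx_const P1 trmx_const.
  apply/negP => /eqP/rowP/(_ (Ordinal n_gt0)).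
  by rewrite !mxE => /eqP; rewrite oner_eq0.
have t_le1 a : a \in t -> a <= 1.
  by rewrite in_t; apply: eigenvalue_le_sum.
case: t t_sorted t_char t1 t_le1 {in_t} => // h s h_sorted -> s1 s_le1.
have -> : h = 1.
  apply/eqP; rewrite eq_le s_le1 ?mem_head//=.
  move: s1; rewrite inE => /predU1P[<-//|].
  by have /allP := order_path_min ge_trans h_sorted; apply.
by exists s; rewrite big_cons.
Qed.

Lemma mu_spectrum (R : realType) n (P : 'M[R]_n) (s : seq R) :
    spectrum P = 1 :: s -> n = (size s).+1 ->
  mu P = \big[Num.max/0]_(x <- s) `|x|.
Proof.
by move=> sP n_s; rewrite /mu sP {1}n_s big_add1 /= [RHS](big_nth 0).
Qed.

Lemma size_spectrum_feasible (R : realType) n (P : 'M[R]_n) (s : seq R) :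
  char_poly P = ('X - 1) * \prod_(x <- s) ('X - x%:P) -> n = (size s).+1.
Proof.
rewrite -polyC1 -(big_cons _ _ 1 s xpredT (fun x => 'X - x%:P)) /=.
by move=> /(congr1 (size \o val)) /=; rewrite size_char_poly size_prod_XsubC => -[].
Qed.

Lemma char_poly_deflated (R : realType) n (e : rel 'I_n) (P : 'M[R]_n) s :
    (0 < n)%N -> feasible e P ->
    char_poly P = ('X - 1) * \prod_(x <- s) ('X - x%:P) ->
  char_poly (P - const_mx n%:R^-1) = 'X * \prod_(x <- s) ('X - x%:P).
Proof.
move=> n_gt0 [_ P1 _ _] Ps; have := char_poly_deflation n_gt0 P1.
by rewrite Ps mulrCA; apply: mulfI; rewrite -polyC1 polyXsubC_eq0.
Qed.

Lemma mulmx_const_eq0 (R : pzRingType) n (x : 'rV[R]_n) (c : R) :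
  x *m (const_mx 1 : 'cV_n) = 0 -> x *m (const_mx c : 'M_n) = 0.
Proof.
move=> x1; have -> : const_mx c = (const_mx 1 : 'cV_n) *m (const_mx c : 'rV_n).
  by apply/matrixP => i j; rewrite !mxE big_ord1 !mxE mul1r.
by rewrite mulmxA x1 mul0mx.
Qed.

(** On vectors orthogonal to the all-ones vector, [P] acts as P - J/n, whose eigenvalues are 0 and
    the members of [s], all of modulus at most [mu P]. *)
Lemma quadratic_form_le_mu (R : realType) n (e : rel 'I_n) (P : 'M[R]_n) (x : 'rV_n) :
    (0 < n)%N -> feasible e P -> x *m (const_mx 1 : 'cV[R]_n) = 0 ->
  `|(x *m P *m x^T) 0 0| <= mu P * (x *m x^T) 0 0.
Proof.
move=> n_gt0 P_feas x1; have [s [sP cP]] := spectrum_feasible n_gt0 P_feas.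
have cM := char_poly_deflated n_gt0 P_feas cP.
set M := P - _ in cM.
have M_sym : M = M^T.
  by case: P_feas => _ _ P_sym _; rewrite /M linearB /= -P_sym trmx_const.
have [d [dM /(_ x)[w [w_ge0 <- wM]]]] := symmetric_diagonalization M_sym.
have -> : x *m P = x *m M.
  by rewrite mulmxBr mulmx_const_eq0// subr0.
rewrite -wM mulr_sumr; apply: le_trans (ler_norm_sum _ _ _) _.
apply: ler_sum => i _; rewrite normrM (ger0_norm (w_ge0 i)) ler_wpM2r//.
have mu_ge0 : 0 <= mu P by rewrite /mu bigmax_ge_id.
have : root (char_poly M) (d i).
  by apply/rootP; rewrite dM horner_prod (bigD1 i)//= hornerXsubC subrr mul0r.
rewrite cM rootM rootX root_prod_XsubC => /predU1P[->|ds]; first by rewrite normr0.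
rewrite (mu_spectrum sP (size_spectrum_feasible cP)).
exact: (le_bigmax_seq 0 (d i) xpredT (fun a => `|a|)).
Qed.

(** Upper bounds on [mu] may be tested on eigenvectors orthogonal to the all-ones vector: P - J/n
    kills that vector, so its eigenvectors for nonzero eigenvalues are orthogonal to it and are
    eigenvectors of [P]. *)
Lemma mu_le (R : realType) n (e : rel 'I_n) (P : 'M[R]_n) (m : R) :
    (0 < n)%N -> feasible e P -> 0 <= m ->
    (forall a (x : 'rV_n), x != 0 -> x *m (const_mx 1 : 'cV[R]_n) = 0 ->
      x *m P = a *: x -> `|a| <= m) ->
  mu P <= m.
Proof.
move=> n_gt0 P_feas m_ge0 le_m; have [s [sP cP]] := spectrum_feasible n_gt0 P_feas.
have cM := char_poly_deflated n_gt0 P_feas cP.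
rewrite (mu_spectrum sP (size_spectrum_feasible cP)).
rewrite big_seq; apply: bigmax_le => // a a_s.
(* The orthogonality argument divides by [a]; for [a = 0] the bound is [0 <= m]. *)
have [->|a0] := eqVneq a 0; first by rewrite normr0.
have : eigenvalue (P - const_mx n%:R^-1) a.
  by rewrite eigenvalue_root_char cM rootM root_prod_XsubC a_s orbT.
case/eigenvalueP => x xM x0.
case: (P_feas) => _ P1 _ _.
have J1 : (const_mx n%:R^-1 : 'M[R]_n) *m (const_mx 1 : 'cV_n) = const_mx 1.
  apply/colP => i; rewrite !mxE (eq_bigr (fun=> n%:R^-1)) => [|j _].
    by rewrite sumr_const card_ord -(mulr_natr n%:R^-1) mulVf// pnatr_eq0 -lt0n.
  by rewrite !mxE mulr1.
have x1 : x *m (const_mx 1 : 'cV[R]_n) = 0.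
  apply: (scalerI a0); rewrite scaler0 scalemxAl -xM -mulmxA mulmxBl P1 J1.
  by rewrite subrr mulmx0.
apply: (le_m _ x) => //.
by rewrite -xM mulmxBr mulmx_const_eq0// subr0.
Qed.

(** * Distances and the intersection matrix *)

Section Distance.
Variables (V : finType) (e : rel V).

Lemma has_walkP k u v :
  reflect (exists p, [/\ size p = k, path e u p & last u p = v])
          (has_walk e k u v).
Proof.
apply: (iffP existsP) => [[p /andP[ep /eqP lp]]|[p [sp ep lp]]].
  by exists p; rewrite size_tuple.
by exists (tcast sp (in_tuple p)); rewrite val_tcast ep lp eqxx.
Qed.

Lemma dist_le k u v : has_walk e k u v -> (dist e u v <= k)%N.
Proof.
move=> kuv; rewrite leqNgt; apply/negP => lt_k.
(* Even the junk value of [dist] is at most [#|V|], so [k] lies in the range searched by [find]. *)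
have lt_kV : (k < #|V|)%N.
  by apply: leq_trans lt_k _; rewrite -[X in (_ <= X)%N](size_iota 0) find_size.
by have := before_find 0%N lt_k; rewrite nth_iota// add0n kuv.
Qed.

Lemma distxx u : dist e u u = 0%N.
Proof. by apply/eqP; rewrite -leqn0; apply/dist_le/has_walkP; exists [::]. Qed.

Lemma dist_automorphism (g : {perm V}) u v :
  automorphism e g -> dist e (g u) (g v) = dist e u v.
Proof.
move=> g_aut; have g_path x p : path e (g x) (map g p) = path e x p.
  by rewrite path_map; apply: eq_path => y z; apply: g_aut.
apply: eq_find => k; apply/has_walkP/has_walkP => -[p [sp ep lp]]; last first.
  by exists (map g p); rewrite size_map g_path last_map lp.
have gK : map g (map (g^-1)%g p) = p by apply: mapK; apply: permKV.
exists (map (g^-1)%g p); split; first by rewrite size_map.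
  by rewrite -g_path gK.
by apply: (@perm_inj _ g); rewrite -last_map gK.
Qed.

Lemma dist_ltS_diameter u v : (dist e u v < (diameter e).+1)%N.
Proof.
rewrite ltnS; apply: leq_trans (leq_bigmax u).
exact: leq_bigmax.
Qed.

Hypothesis e_conn : connected_graph e.

Lemma has_walk_dist u v : has_walk e (dist e u v) u v.
Proof.
have /connectP[p ep ->] := e_conn u v.
(* A path without repeated vertices has fewer than [#|V|] edges, so the search succeeds and [dist]
   is not the junk value. *)
case/shortenP: ep => q eq q_uniq _ {p}.
have H : has (fun k => has_walk e k u (last u q)) (iota 0 #|V|).
  apply/hasP; exists (size q); last by apply/has_walkP; exists q.
  by rewrite mem_iota add0n; have := max_card (mem (u :: q)); rewrite (card_uniqP q_uniq).
have := nth_find 0%N H; rewrite has_find size_iota in H.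
by rewrite nth_iota.
Qed.

Lemma dist_eq0 u v : (dist e u v == 0%N) = (u == v).
Proof.
apply/eqP/eqP => [d0|->]; last exact: distxx.
by have := has_walk_dist u v; rewrite d0 => /has_walkP[[|w p] []].
Qed.

Lemma dist_edge_le u w v : e u w -> (dist e u v <= (dist e w v).+1)%N.
Proof.
move=> uw; have /has_walkP[p [sp ep lp]] := has_walk_dist w v.
by apply/dist_le/has_walkP; exists (w :: p); rewrite /= sp uw.
Qed.

Lemma dist_eq1 u v : irreflexive e -> (dist e u v == 1%N) = e u v.
Proof.
move=> e_irr; apply/eqP/idP => [d1|uv].
  have := has_walk_dist u v; rewrite d1 => /has_walkP[[|w [|w' p]] []] //= _.
  by rewrite andbT => ? <-.
apply/eqP; rewrite eqn_leq -{1}(distxx v) dist_edge_le// lt0n dist_eq0.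
by apply: contraTneq uv => ->; rewrite e_irr.
Qed.

Lemma dist_pred k u v :
  dist e u v = k.+1 -> exists2 w, e u w & dist e w v = k.
Proof.
move=> dk; have := has_walk_dist u v; rewrite dk.
move=> /has_walkP[[|w p] []] //= [sp] /andP[uw ep] lp.
exists w => //; apply/eqP; rewrite eqn_leq; apply/andP; split.
  by apply/dist_le/has_walkP; exists p.
by rewrite -ltnS -dk; apply: dist_edge_le.
Qed.

(** Take [v] as the end of a diametral pair; walking along a shortest path towards [v] lowers the
    distance by one at each step. *)
Lemma exists_all_distances :
  (0 < #|V|)%N ->
  exists v, forall k, (k <= diameter e)%N -> exists u, dist e u v = k.
Proof.
move=> V_gt0; rewrite /diameter.
have [u ->] := @bigop.eq_bigmax V (fun u => \max_v dist e u v)%N V_gt0.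
have [v ->] := @bigop.eq_bigmax V (dist e u) V_gt0; exists v => k /subnK.
move: (_ - k)%N => m; elim: m u => [|m IHm] u; first by rewrite add0n => ->; exists u.
by rewrite addSn => /esym/dist_pred[w _ /esym/IHm].
Qed.

Hypotheses (e_sym : symmetric e) (e_irr : irreflexive e).
Hypothesis e_dt : distance_transitive e.

(** An automorphism carrying the picked pair to [(u, v)] maps one set of counted vertices onto the
    other, so the choice made by [pick] is immaterial. *)
Lemma intersection_numberE u v j :
  intersection_number e (dist e u v) j = #|[pred w | e u w & dist e w v == j]|.
Proof.
rewrite /intersection_number; case: pickP => [[x y] /= /eqP xy|/(_ (u, v))/=]; last first.
  by rewrite eqxx.
have [g [g_aut gx gy]] := e_dt xy.
rewrite -(card_image (@perm_inj _ g)); apply: eq_card => w.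
apply/idP/idP => [/fintype.imageP[z]|].
  rewrite !inE dist_eq1// => /andP[xz /eqP <-] ->.
  by rewrite -gx -gy g_aut dist_automorphism// xz eqxx.
rewrite inE -gx -gy -[w](permKV g) g_aut dist_automorphism// => zP.
by apply: fintype.image_f; rewrite inE dist_eq1.
Qed.

Lemma intersection_matrixE (R : nzRingType) u v (k j : 'I_(diameter e).+1) :
    dist e u v = k ->
  intersection_matrix R e k j = #|[pred w | e u w & dist e w v == j]|%:R.
Proof.
move=> uvk; rewrite mxE /a_num /b_num /c_num -uvk !intersection_numberE.
case: eqP => [->//|/eqP jk]; case: eqP => [->//|/eqP jk1].
(* Off the three diagonals the count is zero, since crossing an edge changes the distance to [v] by
   at most one. *)
case: eqP => [<-//|/eqP j1k]; rewrite (eq_card0 _) // => w; rewrite !inE.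
apply/negP => /andP[uw /eqP wj]; move: jk jk1 j1k.
have := dist_edge_le v uw; have := @dist_edge_le w u v; rewrite e_sym wj => /(_ uw).
by rewrite leq_eqVlt ltnS => /orP[/eqP ->|le1]; rewrite ?eqxx//
  leq_eqVlt ltnS => /orP[/eqP ->|le2]; rewrite ?eqxx// eqn_leq le1 le2.
Qed.

End Distance.

(** * Common spectrum of the adjacency and intersection matrices *)

Lemma char_poly_trmx (R : comNzRingType) n (M : 'M[R]_n) :
  char_poly M^T = char_poly M.
Proof.
by rewrite /char_poly -det_tr; congr (\det _); apply/matrixP => i j; rewrite !mxE eq_sym.
Qed.

Section IntersectionSpectrum.
Variables (R : fieldType) (n : nat) (e : rel 'I_n).
Hypothesis n_gt0 : (0 < n)%N.
Hypotheses (e_conn : connected_graph e) (e_sym : symmetric e).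
Hypotheses (e_irr : irreflexive e) (e_dt : distance_transitive e).

Definition distance_partition v : 'M[R]_(n, (diameter e).+1) :=
  \matrix_(w, k) (dist e w v == k)%:R.

(** The partition by distance to [v] is equitable: the number of neighbours of [u] at distance [j]
    from [v] depends only on [dist e u v]. *)
Lemma adjacency_distance_partition v :
  adjacency R e *m distance_partition v =
  distance_partition v *m intersection_matrix R e.
Proof.
apply/matrixP => u j; rewrite !mxE.
pose k : 'I_(diameter e).+1 := Ordinal (dist_ltS_diameter e u v).
rewrite [RHS](bigD1 k)//= [X in _ = _ + X]big1 ?addr0 => [|i ik]; last first.
  rewrite [X in X * _]mxE; case: eqP => [uvi|_]; last by rewrite mul0r.
  by case/eqP: ik; apply: val_inj.
rewrite (@intersection_matrixE _ _ e_conn e_sym e_irr e_dt R u v k)//.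
rewrite !mxE eqxx mul1r -sum1_card natr_sum.
rewrite [RHS]big_mkcond; apply: eq_bigr => w _; rewrite !mxE inE.
by case: (e u w); case: eqP; rewrite ?mulr1 ?mulr0 ?mul0r.
Qed.

Lemma eigenvalue_adjacency a :
  eigenvalue (adjacency R e) a = eigenvalue (intersection_matrix R e) a.
Proof.
apply/idP/idP.
  case/eigenvalueP => x xA x0.
  have /existsP[v xv] : [exists v, x 0 v != 0].
    apply: contraNT x0 => /existsPn xx; apply/eqP/rowP => v.
    by have := xx v; rewrite negbK mxE => /eqP.
  (* Only [v] is at distance 0 from [v], so entry 0 of this vector is [x 0 v], nonzero by the choice
     of [v]. *)
  apply/eigenvalueP; exists (x *m distance_partition v).
    by rewrite -mulmxA -adjacency_distance_partition mulmxA xA scalemxAl.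
  apply: contra xv => /eqP/rowP/(_ ord0); rewrite !mxE (bigD1 v)//= big1.
    by rewrite mxE distxx eqxx mulr1 addr0 => ->.
  by move=> w wv; rewrite mxE dist_eq0// (negPf wv) mulr0.
(* Transposing turns the row eigenvector into a column eigenvector of the intersection matrix, which
   the partition matrix lifts to the vertices. *)
rewrite eigenvalue_root_char -char_poly_trmx -eigenvalue_root_char.
case/eigenvalueP => z zB z0.
have [k zk] : exists k, z 0 k != 0.
  apply/existsP; apply: contraNT z0 => /existsPn zz; apply/eqP/rowP => v.
  by have := zz v; rewrite negbK mxE => /eqP.
(* The lifted vector takes the value [z 0 k] at each vertex at distance [k] from [v]; such a vertex
   [u] must exist for it to be nonzero. *)
have [] := exists_all_distances e_conn; first by rewrite card_ord.
move=> v /(_ k)[|u uv]; first by rewrite -ltnS.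
have A_sym : adjacency R e = (adjacency R e)^T.
  by apply/matrixP => i j; rewrite !mxE e_sym.
apply/eigenvalueP; exists (z *m (distance_partition v)^T).
  by rewrite A_sym -mulmxA -trmx_mul adjacency_distance_partition
    trmx_mul mulmxA zB scalemxAl.
apply: contra zk => /eqP/rowP/(_ u); rewrite !mxE (bigD1 k)//= big1.
  by rewrite !mxE uv eqxx mulr1 addr0 => ->.
move=> i ik; rewrite !mxE uv; case: eqP => [ki|]; last by rewrite mulr0.
by case/eqP: ik; apply: val_inj.
Qed.

End IntersectionSpectrum.

(** * Averaging over automorphisms *)

Lemma adjacency_sym (R : nzRingType) n (e : rel 'I_n) :
  symmetric e -> adjacency R e = (adjacency R e)^T.
Proof. by move=> e_sym; apply/matrixP => i j; rewrite !mxE e_sym. Qed.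

Lemma adjacency_sum (R : nzRingType) n (e : rel 'I_n) i :
  \sum_j adjacency R e i j = (valency e i)%:R.
Proof.
rewrite /valency -sum1_card natr_sum [RHS]big_mkcond; apply: eq_bigr => j _.
by rewrite mxE inE; case: (e i j).
Qed.

(** A finite set form of [automorphism], over which sums can range. *)
Definition automorphisms (V : finType) (e : rel V) : {set {perm V}} :=
  [set g : {perm V} | [forall x, forall y, e (g x) (g y) == e x y]].

Lemma automorphismsP (V : finType) (e : rel V) (g : {perm V}) :
  reflect (automorphism e g) (g \in automorphisms e).
Proof.
rewrite inE; apply: (iffP forallP) => g_aut x => [y|].
  by have /forallP/(_ y)/eqP := g_aut x.
by apply/forallP => y; apply/eqP.
Qed.

Lemma automorphisms_mulg (V : finType) (e : rel V) (h g : {perm V}) :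
  automorphism e h -> ((h * g)%g \in automorphisms e) = (g \in automorphisms e).
Proof.
move=> h_aut; apply/automorphismsP/automorphismsP => g_aut x y.
  have := g_aut (h^-1 x)%g (h^-1 y)%g; rewrite !permM !permKV => ->.
  by rewrite -h_aut !permKV.
by rewrite !permM g_aut h_aut.
Qed.

Section Averaging.
Variables (R : realType) (n : nat) (e : rel 'I_n) (nu : nat).
Hypotheses (n_gt0 : (0 < n)%N) (nu_gt0 : (0 < nu)%N).
Hypotheses (e_conn : connected_graph e) (e_sym : symmetric e).
Hypotheses (e_irr : irreflexive e) (e_dt : distance_transitive e).
Hypothesis e_val : forall u, valency e u = nu.

(** Here [c] is the common edge value of the average of [P] over the automorphisms. It is chosen
    before [x] and [a], so the same [c] serves for both extreme eigenvalues. *)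
Lemma feasible_average (P : 'M[R]_n) : feasible e P ->
  exists c : R, c * nu%:R <= 1 /\
    (forall (x : 'rV_n) a, x != 0 -> x *m (const_mx 1 : 'cV[R]_n) = 0 ->
      x *m adjacency R e = a *: x -> `|1 - c * (nu%:R - a)| <= mu P).
Proof.
move=> P_feas; have P_sum := feasible_sum1 P_feas.
case: (P_feas) => P_ge0 _ P_sym P_0.
set G := automorphisms e; pose N : R := #|G|%:R.
pose T i j := \sum_(g in G) P (g i) (g j).
have N_gt0 : 0 < N.
  rewrite ltr0n; apply/card_gt0P; exists 1%g; apply/automorphismsP => x y.
  by rewrite !perm1.
(* Edges are the pairs at distance 1, so an automorphism [h] maps one to the other, and translation
   by [h] permutes the terms of [T]. *)
have T_const i j k l : e i j -> e k l -> T k l = T i j.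
  move=> ij kl; have [|h [h_aut <- <-]] := e_dt (u := i) (v := j) (x := k) (y := l).
    by move: ij kl; rewrite -!(dist_eq1 e_conn)// => /eqP-> /eqP->.
  rewrite /T [RHS](reindex_inj (mulgI h)) /=; apply: eq_big => g.
    by rewrite automorphisms_mulg.
  by rewrite !permM.
pose i0 : 'I_n := Ordinal n_gt0.
have /card_gt0P[j0 ij0] : (0 < valency e i0)%N by rewrite e_val.
rewrite inE in ij0; pose c := T i0 j0 / N.
have T_edge i j : e i j -> T i j = N * c.
  by move=> /(T_const _ _ _ _ ij0)->; rewrite mulrC divfK// gt_eqF.
have T_ge0 i j : 0 <= T i j by apply: sumr_ge0.
have T_A i j : i != j -> T i j = N * c * adjacency R e i j.
  move=> ij; rewrite mxE; case: (boolP (e i j)) => [/T_edge->|eij].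
    by rewrite mulr1.
  rewrite mulr0; apply: big1 => g /automorphismsP g_aut.
  by rewrite P_0// ?g_aut// (inj_eq perm_inj).
exists c; split.
  (* Each row of [T] sums to [N]; dropping its nonnegative diagonal entry leaves [nu] edge entries
     equal to [N * c]. *)
  rewrite -(ler_pM2l N_gt0) mulr1 mulrA -(e_val i0) -adjacency_sum mulr_sumr.
  rewrite [leRHS](_ : N = \sum_j T i0 j); last first.
    rewrite exchange_big /= (eq_bigr (fun=> 1)) => [|g _]; first by rewrite sumr_const.
    by rewrite -(P_sum (g i0)) [RHS](reindex_inj (@perm_inj _ g)).
  apply: ler_sum => j _; have [<-|ij] := eqVneq i0 j; last by rewrite T_A.
  by rewrite mxE e_irr mulr0.
move=> x a x0 x1 xA.
have x_gt0 := mulmx_tr_gt0 x0; set q := (x *m x^T) 0 0 in x_gt0.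
(* The inverse makes [y g] at [g i] equal to [x] at [i], so the form of [P] at [y g] is the form at
   [x] of [P] conjugated by [g]. *)
pose y (g : {perm 'I_n}) : 'rV[R]_n := \row_i x 0 ((g^-1)%g i).
have yE g i : y g 0 (g i) = x 0 i by rewrite mxE permK.
have yq g : (y g *m (y g)^T) 0 0 = q.
  rewrite /q !mxE (reindex_inj (@perm_inj _ g)); apply: eq_bigr => i _.
  by rewrite [_^T _ _]mxE [in RHS]mxE yE.
have y1 g : y g *m (const_mx 1 : 'cV[R]_n) = 0.
  rewrite -x1; apply/matrixP => i k; rewrite !mxE (reindex_inj (@perm_inj _ g)).
  by apply: eq_bigr => j _; rewrite !ord1 yE !mxE.
have yP g : g \in G -> `|(y g *m P *m (y g)^T) 0 0| <= mu P * q.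
  by move=> _; rewrite -(yq g); apply: quadratic_form_le_mu P_feas _.
have sum_yP : \sum_(g in G) (y g *m P *m (y g)^T) 0 0 =
    N * (1 - c * (nu%:R - a)) * q.
  apply: (@mulfI _ (2 : R)); first by rewrite pnatr_eq0.
  (* The Dirichlet form of [P], with row sums 1, involves only off-diagonal entries, where [T] is
     known to be a multiple of the adjacency matrix. *)
  have D g : 2 * (y g *m P *m (y g)^T) 0 0 =
      2 * q - \sum_i \sum_j P (g i) (g j) * (x 0 i - x 0 j) ^+ 2.
    have := dirichlet_form (y g) P_sym P_sum; rewrite yq mul1r mulrBr.
    rewrite (reindex_inj (@perm_inj _ g)) (eq_bigr (fun i =>
       \sum_j P (g i) (g j) * (x 0 i - x 0 j) ^+ 2)) => [->|i _]; first by ring.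
    rewrite (reindex_inj (@perm_inj _ g)); apply: eq_bigr => j _.
    by rewrite !yE.
  rewrite mulr_sumr (eq_bigr _ (fun g _ => D g)) sumrB sumr_const.
  rewrite -[X in X - _]mulr_natl -/N.
  have -> : \sum_(g in G) \sum_i \sum_j P (g i) (g j) * (x 0 i - x 0 j) ^+ 2 =
      N * c * \sum_i \sum_j adjacency R e i j * (x 0 i - x 0 j) ^+ 2.
    rewrite exchange_big mulr_sumr; apply: eq_bigr => i _.
    rewrite exchange_big mulr_sumr; apply: eq_bigr => j _.
    rewrite -mulr_suml -/(T i j); have [<-|ij] := eqVneq i j.
      by rewrite subrr expr0n !mulr0.
    by rewrite T_A// -mulrA.
  rewrite (dirichlet_form (r := nu%:R)) ?xA => [||i]; last 2 first.
  - exact: adjacency_sym.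
  - by rewrite adjacency_sum e_val.
  have -> : (a *: x *m x^T) 0 0 = a * q by rewrite -scalemxAl mxE.
  by rewrite -/q; ring.
rewrite -(ler_pM2r x_gt0) -(ler_pM2l N_gt0).
have -> : N * (`|1 - c * (nu%:R - a)| * q) =
    `|\sum_(g in G) (y g *m P *m (y g)^T) 0 0|.
  by rewrite sum_yP !normrM (gtr0_norm N_gt0) (gtr0_norm x_gt0) mulrA.
apply: le_trans (ler_norm_sum _ _ _) _.
apply: (@le_trans _ _ (\sum_(g in G) mu P * q)); first exact: ler_sum.
by rewrite sumr_const -[leLHS]mulr_natl.
Qed.

End Averaging.

(** * The optimal step *)

Section ScalarOptimization.
Variables (R : realFieldType) (nu e1 eD : R).
Hypotheses (nu_gt0 : 0 < nu) (e1_lt : e1 < nu) (eD_le : eD <= e1).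
Let S := 2 * nu - (e1 + eD).

Let S_gt0 : 0 < S.
Proof. by move: nu_gt0 e1_lt eD_le; rewrite /S => *; lra. Qed.

Lemma min_step_gt0 : 0 < Num.min (1 / nu) (2 / S).
Proof. by rewrite lt_min !divr_gt0. Qed.

Lemma min_step_le : Num.min (1 / nu) (2 / S) * nu <= 1.
Proof. by rewrite -ler_pdivlMr// ge_min lexx. Qed.

Lemma max_rate_ge0 : 0 <= Num.max (e1 / nu) ((e1 - eD) / S).
Proof. by rewrite le_max; apply/orP; right; rewrite divr_ge0 ?(ltW S_gt0)// subr_ge0. Qed.

Lemma rate_le_max a : eD <= a -> a <= e1 ->
  `|1 - Num.min (1 / nu) (2 / S) * (nu - a)| <= Num.max (e1 / nu) ((e1 - eD) / S).
Proof.
move=> eD_a a_e1; have := min_step_gt0; set t := Num.min _ _ => t_gt0.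
set m := Num.max _ _.
(* The rate is increasing in [a], so its modulus is controlled by the upper bound at [e1] and the
   lower bound at [eD]. *)
suff [h1 hD] : 1 - t * (nu - e1) <= m /\ t * (nu - eD) - 1 <= m.
  have : t * eD <= t * a by rewrite ler_pM2l.
  have : t * a <= t * e1 by rewrite ler_pM2l.
  move: h1 hD; rewrite ler_norml !mulrBr => *; apply/andP; split; lra.
have nu0 : nu != 0 by rewrite gt_eqF.
have S0 : S != 0 by rewrite gt_eqF.
rewrite /t /m; case: (leP (1 / nu) (2 / S)) => h.
  (* The step 1/nu is the smaller one exactly when S <= 2 nu; then -eD <= e1 and the bound e1/nu
     dominates. *)
  have sum_ge0 : 0 <= e1 + eD.
    by move: h; rewrite ler_pdivrMr// mulrAC ler_pdivlMr// /S => h; lra.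
  have -> : 1 - 1 / nu * (nu - e1) = e1 / nu by field.
  have -> : 1 / nu * (nu - eD) - 1 = - eD / nu by field.
  by split; rewrite le_max ?lexx// ler_pM2r ?invr_gt0//; apply/orP; left; lra.
(* The step 2/S balances the two ends: the rates at [e1] and [eD] are opposite. *)
have -> : 1 - 2 / S * (nu - e1) = (e1 - eD) / S by rewrite /S; field; apply: S0.
have -> : 2 / S * (nu - eD) - 1 = (e1 - eD) / S by rewrite /S; field; apply: S0.
by rewrite le_max lexx orbT.
Qed.

(* The second bound is the convex combination of the two hypotheses with
   weights proportional to [nu - eD] and [nu - e1], which eliminates [c]. *)
Lemma max_rate_le c m : c * nu <= 1 ->
    `|1 - c * (nu - e1)| <= m -> `|1 - c * (nu - eD)| <= m ->
  Num.max (e1 / nu) ((e1 - eD) / S) <= m.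
Proof.
move=> c_nu; rewrite !ler_norml => /andP[_ h1] /andP[hD _].
have c_le : c <= nu^-1 by rewrite -[nu^-1]mul1r ler_pdivlMr.
have d1 : 0 < nu - e1 by rewrite subr_gt0.
have dD : 0 < nu - eD by rewrite subr_gt0 (le_lt_trans eD_le).
rewrite ge_max; apply/andP; split.
  apply: le_trans h1; rewrite lerBrDr -lerBrDl.
  apply: le_trans (ler_wpM2r (ltW d1) c_le) _.
  suff -> : nu^-1 * (nu - e1) = 1 - e1 / nu by [].
  by field; rewrite gt_eqF.
rewrite ler_pdivrMr// /S.
have := ler_wpM2r (ltW dD) h1.
have : (c * (nu - eD) - 1) * (nu - e1) <= m * (nu - e1).
  by rewrite ler_pM2r//; lra.
move=> k1 kD; have := lerD k1 kD; apply: etrans; congr (_ <= _); ring.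
Qed.

End ScalarOptimization.

(** * Adjacency eigenvectors of regular graphs *)

Section RegularGraph.
Variables (R : realType) (n : nat) (e : rel 'I_n) (nu : nat).
Hypotheses (n_gt0 : (0 < n)%N) (e_sym : symmetric e).
Hypothesis e_val : forall u, valency e u = nu.
Let A := adjacency R e.

Lemma adjacency_const : A *m (const_mx 1 : 'cV_n) = nu%:R *: const_mx 1.
Proof.
apply/colP => i; rewrite !mxE mulr1 -(e_val i) -adjacency_sum.
by apply: eq_bigr => j _; rewrite [const_mx _ _ _]mxE mulr1.
Qed.

Lemma eigenvalue_valency : eigenvalue A nu%:R.
Proof.
apply/eigenvalueP; exists (const_mx 1).
  by rewrite -[LHS]trmxK trmx_mul -adjacency_sym// trmx_const adjacency_const
    linearZ /= trmx_const.
apply/eqP => /rowP/(_ (Ordinal n_gt0)); rewrite !mxE.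
by apply/eqP; rewrite oner_eq0.
Qed.

Lemma eigenvalue_le_valency a : eigenvalue A a -> a <= nu%:R.
Proof.
apply: eigenvalue_le_sum => [|i j|i]; first exact: adjacency_sym.
  by rewrite mxE ler0n.
by rewrite adjacency_sum e_val.
Qed.

Lemma eigenvector_sum0 (x : 'rV[R]_n) a :
  x *m A = a *: x -> a != nu%:R -> x *m (const_mx 1 : 'cV_n) = 0.
Proof.
move=> xA a_nu; have : (nu%:R - a) *: (x *m (const_mx 1 : 'cV_n)) = 0.
  by rewrite scalerBl scalemxAr -adjacency_const mulmxA xA scalemxAl subrr.
by move/eqP; rewrite scaler_eq0 subr_eq0 eq_sym (negPf a_nu) => /eqP.
Qed.

(** The Dirichlet form of the adjacency matrix vanishes at [x], so [x] is constant along edges,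
    hence constant by connectedness, and its sum is zero. This is the simplicity of the eigenvalue
    [nu]. *)
Lemma valency_eigenvector_eq0 (x : 'rV[R]_n) : connected_graph e ->
  x *m A = nu%:R *: x -> x *m (const_mx 1 : 'cV_n) = 0 -> x = 0.
Proof.
move=> e_conn xA x1.
have A_sum i : \sum_j A i j = nu%:R by rewrite adjacency_sum e_val.
have := dirichlet_form x (adjacency_sym R e_sym) A_sum.
rewrite -/A xA -scalemxAl [X in _ - X]mxE subrr mulr0 => /eqP.
have ge0 i j : 0 <= A i j * (x 0 i - x 0 j) ^+ 2.
  by rewrite mulr_ge0 ?sqr_ge0// mxE ler0n.
rewrite psumr_eq0 => [/allP z|i _]; last exact: sumr_ge0.
have x_edge i j : e i j -> x 0 i = x 0 j.
  move=> ij; have := z i (mem_index_enum _).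
  rewrite psumr_eq0// => /allP/(_ j (mem_index_enum _)).
  by rewrite mxE ij mul1r sqrf_eq0 subr_eq0 => /eqP.
have x_const i j : x 0 i = x 0 j.
  have /connectP[p ep ->] := e_conn i j.
  by elim: p i ep => //= k p IHp i /andP[/x_edge-> /IHp].
apply/rowP => i; move/matrixP/(_ 0 0): x1; rewrite !mxE.
rewrite (eq_bigr (fun=> x 0 i)) => [|j _]; last by rewrite mxE mulr1.
rewrite sumr_const card_ord => /eqP; rewrite mulrn_eq0.
by rewrite eqn0Ngt n_gt0 => /eqP.
Qed.

End RegularGraph.

(** * Optimality of the common edge probability *)

Theorem corollary3p2 (R : realType) (n : nat) (e : rel 'I_n) (nu : nat)
    (eta : seq R)
    (n_ge2 : (2 <= n)%N)
    (e_sym : symmetric e)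
    (e_irr : irreflexive e)
    (e_conn : connected_graph e)
    (e_dt : distance_transitive e)
    (e_val : forall u : 'I_n, valency e u = nu)
    (eta_size : size eta = (diameter e).+1)
    (eta_decr : sorted >%R eta)
    (eta_eig : forall x : R,
       (x \in eta) = eigenvalue (intersection_matrix R e) x) :
  let eta1 := eta`_1 in
  let etaD := eta`_(diameter e) in
  let alpha := Num.min (1 / nu%:R) (2 / (2 * nu%:R - (eta1 + etaD))) in
  let mustar := Num.max (eta1 / nu%:R)
                        ((eta1 - etaD) / (2 * nu%:R - (eta1 + etaD))) in
  let Pstar : 'M[R]_n := 1%:M - alpha *: (nu%:R%:M - adjacency R e) in
  [/\ feasible e Pstar,
      forall P : 'M[R]_n, feasible e P -> mu Pstar <= mu P
    & mu Pstar = mustar].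
Proof.
move=> eta1 etaD alpha mustar Pstar.
have n_gt0 : (0 < n)%N by apply: leq_trans n_ge2.
have eig_eta a : (a \in eta) = eigenvalue (adjacency R e) a.
  by rewrite eta_eig eigenvalue_adjacency.
pose u0 : 'I_n := Ordinal n_gt0; pose u1 : 'I_n := Ordinal n_ge2.
have nu_gt0 : (0 < nu)%N.
  rewrite -(e_val u0); apply/card_gt0P.
  have /connectP[[|w p] /= ep lp] := e_conn u0 u1; first by case: lp.
  by case/andP: ep => uw _; exists w; rewrite inE.
(* Two distinct vertices exist, so [eta] has at least two entries and [eta1] is a genuine eigenvalue
   rather than the default 0 of [nth]. *)
have D_gt0 : (0 < diameter e)%N.
  rewrite -ltnS; apply: leq_trans (dist_ltS_diameter e u0 u1).
  by rewrite ltnS lt0n dist_eq0.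
have eta_nth : {in [pred k | (k < size eta)%N] &,
    {homo nth 0 eta : i j / (i < j)%N >-> j < i}}.
  by apply: sorted_ltn_nth eta_decr => x y z xy yz; apply: lt_trans yz xy.
have eta_inj k : (k <= diameter e)%N -> eta`_k \in eta.
  by move=> kD; rewrite mem_nth// eta_size.
have eta_le i j : (i <= j)%N -> (j <= diameter e)%N -> eta`_j <= eta`_i.
  rewrite leq_eqVlt => /orP[/eqP->//|ij] jD; apply/ltW/eta_nth => //.
    by rewrite inE eta_size ltnS (leq_trans (ltnW ij)).
  by rewrite inE eta_size ltnS.
have eta0 : eta`_0 = nu%:R.
  apply/eqP; rewrite eq_le; apply/andP; split.
    by apply: eigenvalue_le_valency e_sym e_val _ _; rewrite -eig_eta eta_inj.
  have /(nthP 0)[k] : nu%:R \in eta by rewrite eig_eta eigenvalue_valency.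
  by rewrite eta_size ltnS => kD <-; apply: eta_le.
have eta1_lt : eta1 < nu%:R.
  by rewrite -eta0; apply: eta_nth => //; rewrite inE eta_size ltnS.
have etaD_le : etaD <= eta1 by apply: eta_le.
have eta_bound a : a \in eta -> a != nu%:R -> etaD <= a <= eta1.
  case/(nthP 0) => [[|k]]; rewrite eta_size ltnS => kD <-; first by rewrite eta0 eqxx.
  by rewrite !eta_le.
have nuR : 0 < nu%:R :> R by rewrite ltr0n.
have alpha_gt0 : 0 < alpha by apply: min_step_gt0.
have alpha_nu : alpha * nu%:R <= 1 by apply: min_step_le.
have P_feas : feasible e Pstar.
  split=> [i j||| i j ij eij].
  - rewrite !mxE; have [<-|ij] := eqVneq i j.
      (* The diagonal entries are [1 - alpha * nu%:R], nonnegative by [alpha_nu]. *)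
      by rewrite e_irr subr0 !mulr1n subr_ge0.
    by rewrite !mulr0n !sub0r mulrN opprK mulr_ge0 ?ler0n// ltW.
  - rewrite mulmxBl mul1mx -scalemxAl mulmxBl mul_scalar_mx (adjacency_const R e_val).
    by rewrite subrr scaler0 subr0.
  - rewrite linearB linearZ /= linearB /= !tr_scalar_mx.
    by rewrite -(adjacency_sym R e_sym).
  - by rewrite !mxE (negPf ij) (negPf eij) !mulr0n subrr mulr0 subrr.
have lower P : feasible e P -> mustar <= mu P.
  move=> /(feasible_average n_gt0 nu_gt0 e_conn e_sym e_irr e_dt e_val)[c [c_nu cP]].
  have bound a : a \in eta -> a != nu%:R -> `|1 - c * (nu%:R - a)| <= mu P.
    rewrite eig_eta => /eigenvalueP[x xA x0] a_nu; apply: (cP x) => //.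
    exact: (eigenvector_sum0 e_val xA a_nu).
  apply: max_rate_le c_nu _ _ => //.
    by apply: bound; rewrite ?eta_inj// lt_eqF.
  by apply: bound; rewrite ?eta_inj// lt_eqF// (le_lt_trans etaD_le).
have upper : mu Pstar <= mustar.
  apply: (mu_le n_gt0 P_feas) => [|a x x0 x1 xP]; first exact: max_rate_ge0.
  (* The adjacency eigenvalue corresponding to [a], obtained by inverting the affine map theta -> 1
     - alpha (nu - theta). *)
  pose t := nu%:R - (1 - a) / alpha.
  have aE : a = 1 - alpha * (nu%:R - t).
    by rewrite /t; field; rewrite gt_eqF.
  have xA : x *m adjacency R e = t *: x.
    move: xP; rewrite mulmxBr mulmx1 -scalemxAr mulmxBr mul_mx_scalar aE.
    move=> xP; apply: (scalerI (lt0r_neq0 alpha_gt0)); apply/rowP => i.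
    have := congr1 (fun v : 'rV_n => v 0 i) xP; move: t (x *m _) {aE xP} => t w.
    by rewrite !mxE; lra.
  have t_nu : t != nu%:R.
    apply: contra x0 => /eqP t_nu; apply/eqP; rewrite t_nu in xA.
    exact: (valency_eigenvector_eq0 n_gt0 e_sym e_val).
  have /andP[tD t1] : etaD <= t <= eta1.
    by apply: eta_bound => //; rewrite eig_eta; apply/eigenvalueP; exists x.
  by rewrite aE; apply: rate_le_max.
have muE : mu Pstar = mustar by apply/eqP; rewrite eq_le upper lower.
by split=> // P /lower; rewrite muE.
Qed.
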